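(* There exists a share allocation such that slice loads and BTD constraints $((\rho^v,\tilde{\boldsymbol\rho}^v,d_v):v\in\mathcal V)$ are admissible under SCPF sharing (in the high-load sense described in the context) if and only if there exists a vector $\boldsymbol s=(s^v:v\in\mathcal V)$ such that $\|\boldsymbol s\|_1=1$, $\boldsymbol s\succeq\boldsymbol 0$ and $$\sum_{v\in\mathcal V}s^v\boldsymbol h^v\succeq\boldsymbol 0$$ (componentwise), where the share coupling vectors $\boldsymbol h^v=(h_u^v:u\in\mathcal V)$ are given by $$h_u^v=\begin{cases}1,&v=u,\\[4pt]-\dfrac{1+\rho^u}{l(d_u,\tilde{\boldsymbol\rho}^u,\boldsymbol\delta^u)-\rho^u}\cdot\dfrac{\langle\tilde{\boldsymbol\rho}^u,\tilde{\boldsymbol\rho}^v\rangle_{\boldsymbol\Delta^u}}{\|\tilde{\boldsymbol\rho}^u\|_{\boldsymbol\Delta^u}^2},&v\ne u.\end{cases}$$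
   Context: $\mathcal B$ (base stations) and $\mathcal V$ (slices) are finite nonempty sets. For each slice $v$: $\rho^v>0$ is its overall load; $\tilde{\boldsymbol\rho}^v=(\tilde\rho_b^v)_{b\in\mathcal B}$ its relative load distribution, with $\tilde\rho_b^v\ge0$ and $\sum_b\tilde\rho_b^v=1$; $\boldsymbol\delta^v=(\delta_b^v)_b$ with $\delta_b^v>0$ its mean reciprocal capacities; $\boldsymbol\Delta^v=\mathrm{diag}(\boldsymbol\delta^v)$; and $d_v>\langle\tilde{\boldsymbol\rho}^v,\boldsymbol\delta^v\rangle$ its target mean bit transmission delay (BTD). For diagonal $\boldsymbol M$, $\langle\boldsymbol x,\boldsymbol y\rangle_{\boldsymbol M}=\boldsymbol x^T\boldsymbol M\boldsymbol y$, $\|\boldsymbol x\|_{\boldsymbol M}^2=\boldsymbol x^T\boldsymbol M\boldsymbol x$. Define $$l(d_v,\tilde{\boldsymbol\rho}^v,\boldsymbol\delta^v)=\frac{d_v-\langle\tilde{\boldsymbol\rho}^v,\boldsymbol\delta^v\rangle}{\|\tilde{\boldsymbol\rho}^v\|_{\boldsymbol\Delta^v}^2}.$$ Each slice $v$ is allocated a share $s^v$ of the network resources; in the sharing model shares satisfy $s^v>0$ and $\sum_v s^v=1$. The high overall load assumption ($\rho^v\gg1$ for all $v$) is in force: terms in $e^{-\rho^v}$ are neglected and the mean BTD of a typical customer of slice $v$ under Share Constrained Proportionally Fair (SCPF) sharing with shares $(s^v)$ is taken to be $$D_v(\boldsymbol s)=\langle\tilde{\boldsymbol\rho}^v,\boldsymbol\delta^v\rangle-\|\tilde{\boldsymbol\rho}^v\|_{\boldsymbol\Delta^v}^2+\frac{\rho^v+1}{s^v}\langle\tilde{\boldsymbol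 g},\tilde{\boldsymbol\rho}^v\rangle_{\boldsymbol\Delta^v},\qquad \tilde{\boldsymbol g}=\sum_{w\in\mathcal V}s^w\tilde{\boldsymbol\rho}^w.$$ The loads and constraints are admissible for a share allocation $\boldsymbol s$ if every slice meets its requirement, $D_v(\boldsymbol s)\le d_v$ for all $v\in\mathcal V$; the paper writes this requirement as $$s^v\ \ge\ \frac{1+\rho^v}{l(d_v,\tilde{\boldsymbol\rho}^v,\boldsymbol\delta^v)-\rho^v}\sum_{u\ne v}s^u\,\frac{\langle\tilde{\boldsymbol\rho}^v,\tilde{\boldsymbol\rho}^u\rangle_{\boldsymbol\Delta^v}}{\|\tilde{\boldsymbol\rho}^v\|_{\boldsymbol\Delta^v}^2}\qquad\text{for all }v\in\mathcal V.$$
   Formalization: Assumes l(d_v,ρ~^v,δ^v) > ρ^v for every slice (otherwise false or undefined), and lets share allocations have s^v ≥ 0 rather than s^v > 0; at s^v = 0 the BTD is +∞ if a slice with positive share loads v's base stations and finite otherwise. *)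

(* Defs.v *)
From mathcomp Require Import all_boot all_order all_algebra.
From mathcomp Require Import reals constructive_ereal.

Set Implicit Arguments.
Unset Strict Implicit.
Unset Printing Implicit Defensive.

Import Order.TTheory GRing.Theory Num.Theory.
Local Open Scope ring_scope.

Section Vectors.
Variables (R : realType) (I : finType).
Implicit Types m x y : I -> R.

Definition dotp x y : R := \sum_i x i * y i.

(* <x, y>_M and ||x||_M^2 for M = diag(m); only the diagonal m is stored. *)
Definition wdotp m x y : R := \sum_i x i * m i * y i.
Definition wnorm2 m x : R := wdotp m x x.

Definition norm1 x : R := \sum_i `|x i|.

End Vectors.

Section Slicing.
Variables (R : realType) (B V : finType).
(* rho v : overall load; trho v : relative load distribution over B;
   delta v : mean reciprocal capacities; d v : target mean BTD. *)
Variables (rho : V -> R) (trho delta : V -> B -> R) (d : V -> R).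
Implicit Types (s : V -> R) (u v w : V) (b : B).

(* rho v < lfun v is what makes the bound on shares
   s v >= (1 + rho v) / (lfun v - rho v) * (...) equivalent to meanBTD <= d v:
   even without competing slices the mean BTD exceeds d v when lfun v < rho v,
   and the bound is undefined when lfun v = rho v. *)
Definition lfun v : R :=
  (d v - dotp (trho v) (delta v)) / wnorm2 (delta v) (trho v).

Definition gtilde s b : R := \sum_w s w * trho w b.

(* Mean BTD under SCPF sharing, terms in exp (- rho v) being neglected.
   For s v > 0 this is the usual real number. It is extended-real valued only
   so that it makes sense at s v = 0, where the conventions 0^-1 = +oo and
   +oo * 0 = 0 of \bar R give +oo if slices with a positive share put load on
   a base station used by v, and a finite value otherwise. *)
Definition meanBTD s v : \bar R :=
  ((dotp (trho v) (delta v) - wnorm2 (delta v) (trho v))%:E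
   + (rho v + 1)%:E / (s v)%:E
     * (wdotp (delta v) (gtilde s) (trho v))%:E)%E.

Definition admissible s : Prop := forall v, (meanBTD s v <= (d v)%:E)%E.

(* Shares are taken in the closed simplex: with s v > 0 required for all v,
   the equivalence with the existence of a nonnegative solution of the coupling
   inequalities fails when the slices split into groups using disjoint sets of
   base stations, one group being infeasible and another feasible. *)
Definition share_allocation s : Prop :=
  (forall v, 0 <= s v) /\ \sum_v s v = 1.

(* share_coupling v u is the u-th component of the vector h^v. *)
Definition share_coupling v u : R :=
  if v == u then 1
  else - ((1 + rho u) / (lfun u - rho u)
          * (wdotp (delta u) (trho u) (trho v) / wnorm2 (delta u) (trho u))).

End Slicing.

(* Main.v *)
(** For a fixed nonnegative [s] the two conditions agree slice by slice. With
    [N] the squared norm of slice [u] and [S] its coupling to the other slices,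
    the delay bound at [s u > 0] reads [(rho + 1) (s u N + S) <= s u (l + 1) N],
    that is [(rho + 1) S <= s u (l - rho) N]. At [s u = 0] both conditions say
    that [S = 0]. *)
Require Import Defs.
From mathcomp Require Import all_boot all_order all_algebra.
From mathcomp Require Import reals constructive_ereal.
From mathcomp Require Import ring lra.
Import Order.TTheory GRing.Theory Num.Theory.
Local Open Scope ring_scope.

Section Coupling.
Context {R : realType} {B V : finType}.
Implicit Types (rho d s : V -> R) (trho delta : V -> B -> R) (m x : B -> R).

(** A vanishing sum of nonnegative terms has only zero terms; positive weights then force [x = 0],
    against its nonzero total. *)
Lemma wnorm2_gt0 m x : (forall b, 0 < m b) -> \sum_b x b != 0 -> 0 < wnorm2 m x.
Proof.
move=> m_gt0 x_neq0.
have term_ge0 b : 0 <= x b * m b * x b.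
  by rewrite mulrAC -expr2 mulr_ge0 ?sqr_ge0 // ltW.
rewrite lt0r sumr_ge0 ?andbT; last by move=> b _; exact: term_ge0.
apply: contra x_neq0; rewrite psumr_eq0 => [/allP x0|b _]; last exact: term_ge0.
rewrite big1// => b _; have := x0 b (mem_index_enum b).
by rewrite /= !mulf_eq0 (gt_eqF (m_gt0 b)) orbF orbb => /eqP.
Qed.

(** The coupling [S] above: what the load term of [meanBTD] keeps once the contribution of slice [u]
    itself is removed. *)
Definition cross_load trho delta s u : R :=
  \sum_(v | v != u) s v * wdotp (delta u) (trho u) (trho v).

Lemma cross_load_ge0 trho delta s u :
  (forall v b, 0 <= trho v b) -> (forall v b, 0 <= delta v b) ->
  (forall v, 0 <= s v) -> 0 <= cross_load trho delta s u.
Proof.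
move=> trho_ge0 delta_ge0 s_ge0; apply: sumr_ge0 => v _.
by rewrite mulr_ge0// sumr_ge0// => b _; rewrite !mulr_ge0.
Qed.

Lemma wdotp_gtilde trho delta s u :
  wdotp (delta u) (gtilde trho s) (trho u) =
  s u * wnorm2 (delta u) (trho u) + cross_load trho delta s u.
Proof.
transitivity (\sum_v s v * wdotp (delta u) (trho u) (trho v)); last first.
  by rewrite (bigD1 u).
under [RHS]eq_bigr => v _ do rewrite mulr_sumr.
rewrite exchange_big; apply: eq_bigr => b _ /=.
rewrite /gtilde -mulrA mulr_suml; apply: eq_bigr => v _; ring.
Qed.

(** All off-diagonal entries at [u] carry the same factor depending on [u] alone, which comes out of
    the sum. *)
Lemma share_coupling_sum rho trho delta d s u :
  \sum_v s v * share_coupling rho trho delta d v u =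
  s u - (1 + rho u) / (lfun trho delta d u - rho u)
        * (cross_load trho delta s u / wnorm2 (delta u) (trho u)).
Proof.
rewrite (bigD1 u)//= {1}/share_coupling eqxx mulr1; congr (_ + _).
rewrite /cross_load mulr_suml mulr_sumr -sumrN; apply: eq_bigr => v vu.
by rewrite /share_coupling (negbTE vu); ring.
Qed.

Lemma meanBTD_le rho trho delta d s u :
  0 < rho u -> 0 < wnorm2 (delta u) (trho u) ->
  dotp (trho u) (delta u) < d u -> rho u < lfun trho delta d u ->
  0 <= s u -> 0 <= cross_load trho delta s u ->
  (meanBTD rho trho delta s u <= (d u)%:E)%E =
  (0 <= \sum_v s v * share_coupling rho trho delta d v u).
Proof.
move=> rho_gt0 N_gt0 d_gt l_gt s_ge0 S_ge0.
rewrite share_coupling_sum /meanBTD wdotp_gtilde.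
(* Solving the definition of [lfun] for [d u] puts both conditions in terms of the same
   quantities. *)
have dE : d u = dotp (trho u) (delta u)
                + lfun trho delta d u * wnorm2 (delta u) (trho u).
  by rewrite /lfun divfK ?gt_eqF//; ring.
move: (lfun _ _ _ _) (wnorm2 _ _) (dotp _ _) (cross_load _ _ _ _) (rho u) (s u)
  (d u) dE rho_gt0 N_gt0 d_gt l_gt s_ge0 S_ge0.
move=> l N a S r t D -> r_gt0 N_gt0 D_gt l_gt; rewrite le_eqVlt.
have r1_gt0 : 0 < r + 1 by rewrite addr_gt0.
have lr_gt0 : 0 < l - r by rewrite subr_gt0.
case/predU1P => [<-|t_gt0] S_ge0.
  (* Zero share: as [0^-1 = +oo] and [r + 1 > 0], the last delay term becomes [+oo * S]. *)
  rewrite mul0r add0r inve0 mulry gtr0_sg// mul1e.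
  rewrite sub0r oppr_ge0; move: S_ge0; rewrite le_eqVlt => /predU1P[<-|S_gt0].
    (* Here [+oo * 0 = 0], and [a - N <= a + l * N] follows from [D_gt] and [N_gt0]. *)
    rewrite mule0 adde0 lee_fin mul0r mulr0 lexx.
    by apply/idP; lra.
  (* For [S > 0] the delay is infinite, and the coupling sum is negative because [l > r]: both sides
     are false. *)
  rewrite gt0_mulye ?lte_fin// addey// leye_eq /=; apply/esym/negbTE.
  by rewrite -ltNge !(mulr_gt0, invr_gt0)// addrC.
rewrite inver gt_eqF// -!EFinM -EFinD lee_fin -subr_ge0.
(* Scaled by [t] and by [(l - r) * N] respectively, both sides become
   [t * (l - r) * N - (r + 1) * S]. *)
rewrite -[LHS](pmulr_rge0 _ t_gt0) -[RHS](pmulr_rge0 _ (mulr_gt0 lr_gt0 N_gt0)).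
congr (0 <= _); field.
by rewrite !gt_eqF.
Qed.

End Coupling.

Theorem theorem2 (R : realType) (B V : finType)
  (rho : V -> R) (trho delta : V -> B -> R) (d : V -> R)
  (B_nonempty : (0 < #|B|)%N) (V_nonempty : (0 < #|V|)%N)
  (rho_gt0 : forall v, 0 < rho v)
  (trho_ge0 : forall v b, 0 <= trho v b)
  (trho_sum1 : forall v, \sum_b trho v b = 1)
  (delta_gt0 : forall v b, 0 < delta v b)
  (d_gt : forall v, dotp (trho v) (delta v) < d v)
  (rho_lt_l : forall v, rho v < lfun trho delta d v) :
  (exists s : V -> R,
     share_allocation s /\ admissible rho trho delta d s)
  <->
  (exists s : V -> R,
     [/\ norm1 s = 1,
         forall v, 0 <= s v
       & forall u, 0 <= \sum_v s v * share_coupling rho trho delta d v u]).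
Proof.
have norm1E (s : V -> R) : (forall v, 0 <= s v) -> norm1 s = \sum_v s v.
  by move=> s_ge0; apply: eq_bigr => v _; rewrite ger0_norm.
have admE (s : V -> R) u : (forall v, 0 <= s v) ->
    (meanBTD rho trho delta s u <= (d u)%:E)%E =
    (0 <= \sum_v s v * share_coupling rho trho delta d v u).
  move=> s_ge0; apply: meanBTD_le => //.
    by apply: wnorm2_gt0; rewrite ?trho_sum1 ?oner_neq0.
  by apply: cross_load_ge0 => // v b; exact: ltW.
(* The same [s] is the witness in both directions. *)
split=> [[s [[s_ge0 s_sum1] adm]]|[s [s_norm1 s_ge0 coupl]]]; exists s.
  by split=> // [|u]; [rewrite norm1E | rewrite -admE].
by split=> [|u]; [split; rewrite -?norm1E | rewrite admE].
Qed.
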